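(* Let $X$ be a zero-dimensional topological space. The following are equivalent: (1) $C_p(X)$ has the Pytkeev property. (2) Each clopen $\omega$-cover of $X$ contains a countable $\omega$-cover of $X$; and for each continuous image $\mathcal{F}$ of $X$ in $[\mathbb{N}]^{\aleph_0}$ which is free and centered, there is a partition $\langle\mathcal{F}\rangle=\bigcup_{n\in\mathbb{N}}\mathcal{F}_n$ such that each $\mathcal{F}_n$ has a pseudo-intersection. (3) Each clopen $\omega$-cover $\mathcal{U}$ of $X$ contains infinite subsets $\mathcal{U}_1,\mathcal{U}_2,\dots$ such that $\{\bigcap\mathcal{U}_n : n\in\mathbb{N}\}$ is an $\omega$-cover of $X$.
   Context: For a topological space $X$, $C_p(X)$ is the set of all continuous functions $f:X\to\mathbb{R}$ with the subspace topology inherited from the Tychonoff product $\mathbb{R}^X$. A space is zero-dimensional if it has a base consisting of clopen sets. A topological space $Y$ has the Pytkeev property if for each $A\subseteq Y$ and each $y\in\overline{A}\setminus A$ there exist infinite subsets $A_1,A_2,\dots$ of $A$ such that each neighborhood of $y$ contains some $A_n$. A family $\mathcal{U}$ of subsets of $X$ is an $\omega$-cover of $X$ if $X\notin\mathcal{U}$ but each finite $F\subseteq X$ is contained in some $U\in\mathcal{U}$. It is a clopen $\omega$-cover if all its members are clopen in $X$. $[\mathbb{N}]^{\aleph_0}$ is the family of infinite subsets of $\mathbb{N}$, viewed as a subspace of $\mathcal{P}(\mathbb{N})$, which is identified with the product space $\{0,1\}^{\mathbb{N}}$ via characteristic functions. A continuous image of $X$ in $[\mathbb{N}]^{\aleph_0}$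 is a set $\mathcal{F}=\Psi[X]$ with $\Psi:X\to[\mathbb{N}]^{\aleph_0}$ continuous. A family $\mathcal{F}\subseteq[\mathbb{N}]^{\aleph_0}$ is centered if the intersection of each nonempty finite subfamily is infinite, and free if $\bigcap\mathcal{F}=\emptyset$. $\langle\mathcal{F}\rangle$ is the closure of $\mathcal{F}$ under intersections of (nonempty) finite subsets. A pseudo-intersection of a family is an infinite set $A\subseteq\mathbb{N}$ such that $A\setminus B$ is finite for all $B$ in the family. Partitions into countably many pieces may have empty pieces. *)

(* Defs.v *)
From HB Require Import structures.
From mathcomp Require Import all_boot all_order all_algebra.
From mathcomp Require Import all_classical all_reals all_analysis.
Import numFieldNormedType.Exports.

Set Implicit Arguments.
Unset Strict Implicit.
Unset Printing Implicit Defensive.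

Local Open Scope classical_set_scope.

(* MathComp-Analysis' [zero_dimensional] instead means that any two distinct
   points are separated by a clopen set. *)
Definition has_clopen_base (X : topologicalType) : Prop :=
  exists B : set (set X), basis B /\ B `<=` clopen.

(* A set of functions, to be used through [set_type (Cp R X)], whose topology
   is the initial one for the inclusion in the product {ptws X -> R}. *)
Definition Cp (R : realType) (X : topologicalType) : set {ptws X -> R} :=
  [set f | continuous (f : X -> R)].
Arguments Cp R X _ : clear implicits.

Definition pytkeev (Y : topologicalType) : Prop :=
  forall (A : set Y) (y : Y), (closure A `\` A) y ->
  exists A_ : nat -> set Y,
    (forall n, A_ n `<=` A /\ infinite_set (A_ n)) /\
    (forall U, nbhs y U -> exists n, A_ n `<=` U).

Definition omega_cover (X : Type) (U : set (set X)) : Prop :=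
  ~ U [set: X] /\
  forall F : set X, finite_set F -> exists2 V, U V & F `<=` V.

Definition clopen_omega_cover (X : topologicalType) (U : set (set X)) : Prop :=
  omega_cover U /\ U `<=` clopen.

Definition nat_subset (b : nat -> bool) : set nat := [set n | b n].

(* Subsets of nat are encoded by their characteristic functions; [bool] is
   discrete and [set_type inf_subsets] carries the subspace topology. *)
Definition inf_subsets : set {ptws nat -> bool} :=
  [set b | infinite_set (nat_subset b)].

Definition image_family (X : Type) (Psi : X -> set_type inf_subsets) :
    set (set nat) :=
  range (fun x => nat_subset (set_val (Psi x))).

Definition continuous_image (X : topologicalType) (F : set (set nat)) : Prop :=
  exists Psi : X -> set_type inf_subsets,
    continuous Psi /\ F = image_family Psi.

(* Only nonempty subfamilies are intersected, whereas the library's [finI_from]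
   also allows the empty one, whose intersection is [setT]. *)
Definition fin_meets (F : set (set nat)) : set (set nat) :=
  [set B | exists G : set (set nat),
    [/\ finite_set G, G !=set0, G `<=` F & B = \bigcap_(A in G) A]].

Definition centered (F : set (set nat)) : Prop :=
  forall B, fin_meets F B -> infinite_set B.

Definition free_family (F : set (set nat)) : Prop :=
  \bigcap_(A in F) A = set0.

Definition pseudo_intersection (F : set (set nat)) (A : set nat) : Prop :=
  infinite_set A /\ forall B, F B -> finite_set (A `\` B).

(* Main.v *)
(* Condition (3) is the hub.  (1) => (3) tests the Pytkeev property at 0 on the
   indicators of the complements of the members of the cover.  (2) <=> (3)
   encodes a countable cover (U_n) as the map x |-> {n : x in U_n}: the sets of
   indices of subfamilies whose intersections form an omega-cover are exactly
   the (tails of) pseudo-intersections.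
   For (3) => (1), condition (3) yields countable omega-subcovers, hence every
   clopen cover has a countable subcover, and so disjoint zero sets are
   separated by clopen sets.  The cozero sets {|f - y| < 1/(n+1)} can therefore
   be replaced by clopen sets C(n, f), to which (3) applies, unless C(n, f) = X
   for arbitrarily large n; in that case A contains functions arbitrarily
   uniformly close to y, and all functions of A within 1/(k+1) of y serve as
   the k-th infinite set. *)
Require Import Defs.
From HB Require Import structures.
From mathcomp Require Import all_boot all_order all_algebra.
From mathcomp Require Import all_classical all_reals all_analysis.
From mathcomp Require Import lra.
Import numFieldNormedType.Exports.
Import Order.TTheory GRing.Theory Num.Theory.

Set Implicit Arguments.
Unset Strict Implicit.
Unset Printing Implicit Defensive.

Local Open Scope classical_set_scope.

(** * Finite and infinite sets *)

Lemma finite_set_nat_bounded (A : set nat) :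
  finite_set A -> exists m, forall n, A n -> (n <= m)%N.
Proof.
move=> /finite_seqP[s ->]; exists (\max_(i <- s) i) => n /= ns.
exact: (leq_bigmax_seq (P := xpredT) (F := id) n ns).
Qed.

Lemma finite_sub_range (S T : Type) (h : S -> T) (G : set T) :
  finite_set G -> G `<=` range h ->
  exists2 F : set S, finite_set F & G = h @` F.
Proof.
move=> finG Gh.
have /choice[k kP] : forall g : T, exists D : set S,
    finite_set D /\ (G g -> D !=set0 /\ forall x, D x -> h x = g).
  move=> g; have [/Gh[x _ <-]|] := pselect (G g); last by exists set0.
  by exists [set x]; split=> // _; split; [exists x | move=> ? ->].
exists (\bigcup_(g in G) k g).
  by apply: bigcup_finite => // g _; case: (kP g).
apply/seteqP; split=> [g Gg|_ [x [g Gg kgx] <-]].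
  have [_ /(_ Gg)[[x kx] hx]] := kP g.
  by exists x; [exists g | exact: hx].
by have [_ /(_ Gg)[_ /(_ _ kgx) ->]] := kP g.
Qed.

(** Each element of a finite [A n] would have left the sequence by some stage; beyond the largest
    such stage the sets, still contained in [A n], would be empty. *)
Lemma infinite_decreasing_sets (T : Type) (A : nat -> set T) :
  (forall m n, (m <= n)%N -> A n `<=` A m) -> (forall n, A n !=set0) ->
  \bigcap_n A n = set0 -> forall n, infinite_set (A n).
Proof.
move=> decA A0 capA n finA.
have /choice[r rP] : forall x : T, exists m, ~ A m x.
  move=> x; apply/existsNP => Ax.
  by have : set0 x by rewrite -capA => m _; exact: Ax.
have [m mP] := finite_set_nat_bounded (finite_image r finA).
have [x Ax] := A0 (maxn n m).
apply: (rP x); apply: (decA _ (maxn n m)); last exact: Ax.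
rewrite leq_max mP ?orbT//.
by exists x => //; apply: (decA _ (maxn n m)); rewrite ?leq_maxl.
Qed.

Lemma infinite_preimage_image (S T : Type) (h : S -> T) (A : set S)
    (B : set T) :
  infinite_set B -> B `<=` h @` A -> infinite_set (A `&` h @^-1` B).
Proof.
move=> infB BA /(finite_image h); apply: contra_not infB.
apply: sub_finite_set => b Bb; have [a Aa hab] := BA _ Bb.
by exists a => //; split=> //=; rewrite hab.
Qed.

Lemma infinite_image (S T : Type) (h : S -> T) (A : set S) :
  injective h -> infinite_set A -> infinite_set (h @` A).
Proof.
move=> hI infA /(finite_preimage (in2W hI)); apply: contra_not infA.
exact/sub_finite_set/preimage_image.
Qed.

Lemma infinite_nat_tail (A : set nat) (m : nat) :
  infinite_set A -> infinite_set [set k | A k /\ (m <= k)%N].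
Proof.
move=> infA; apply: contra_not infA => fin.
apply: (sub_finite_set _ (_ : finite_set (`I_m `|` _))); last first.
  by rewrite finite_setU; split; [exact: finite_II | exact: fin].
by move=> k Ak /=; case: (ltnP k m) => mk; [left | right].
Qed.

Lemma nat_enum_countType (T : countType) (x0 : T) :
  exists p : nat -> T, forall q, exists k, p k = q.
Proof.
exists (fun k => odflt x0 (unpickle k)) => q.
by exists (pickle q); rewrite pickleK.
Qed.

(** * General facts on omega-covers *)

Section OmegaCovers.
Context {X : Type}.
Implicit Types (F V : set X) (U : set (set X)).

(** If there were only finitely many such [V], one could add to [F] a point missed by each of them;
    a member containing the enlarged finite set would contain a point that it misses. *)
Lemma omega_cover_infinite_above {U F} :
  omega_cover U -> finite_set F -> infinite_set [set V | U V /\ F `<=` V].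
Proof.
move=> [UT Ucov] finF finUF.
have /choice[w wP] : forall V, exists W : set X,
    finite_set W /\ (V <> setT -> ~ W `<=` V).
  move=> V; have [->|/eqP] := eqVneq V setT; first by exists set0.
  rewrite -subTset => /existsNP[x] /not_implyP[_ Vx].
  by exists [set x]; split=> // _ /(_ x erefl).
have [|V UV] :=
    Ucov (F `|` \bigcup_(V in [set V | U V /\ F `<=` V]) w V).
  rewrite finite_setU; split=> //; apply: bigcup_finite => // V _.
  by case: (wP V).
rewrite subUset => -[FV wV].
have [_] := wP V; apply; first by move=> VT; apply: UT; rewrite -VT.
by apply: subset_trans wV; apply: bigcup_sup.
Qed.

Lemma omega_cover_bigcap U (W : nat -> set (set X)) :
  ~ U setT -> (forall n, W n `<=` U /\ infinite_set (W n)) ->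
  (forall F, finite_set F -> exists n, forall V, W n V -> F `<=` V) ->
  omega_cover (range (fun n => \bigcap_(V in W n) V)).
Proof.
move=> UT WP Wcov; split=> [[n _ capT]|F /Wcov[n FW]].
  have [WU /infinite_setN0[V WV]] := WP n.
  apply: UT; rewrite -(_ : V = setT); first exact: WU.
  by rewrite -subTset -capT; exact: bigcap_inf.
by exists (\bigcap_(V in W n) V); [exists n | move=> x Fx V /FW; exact].
Qed.

End OmegaCovers.

(** * Pointwise convergence and the topology of $C_p(X)$ *)

(** Serves both subspaces of products in play, $C_p(X)$ and the space of infinite subsets of
    $\mathbb{N}$, by reducing convergence there to coordinates. *)
Lemma cvg_ptws_subtype (S : topologicalType) (T : uniformType)
    (A : set {ptws S -> T}) (F : set_system (set_type A)) (y : set_type A) :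
  Filter F ->
  F --> y <-> forall s,
    (set_val g : S -> T) s @[g --> F] --> (set_val y : S -> T) s.
Proof.
move=> FF.
have <- : {ptws, set_val @ F --> (set_val y : S -> T)} <-> F --> y.
  split=> [Fy U [_ [[W oW <-] Wy WU]]|Fy].
    by apply: filterS WU _; apply: (Fy W); exact: open_nbhs_nbhs.
  by apply: cvg_trans (@initial_continuous _ _ set_val y); exact: cvg_app.
exact: (pointwise_cvgP (F := set_val @ F)).
Qed.

Lemma continuous_ptws_subtype (X S : topologicalType) (T : uniformType)
    (A : set {ptws S -> T}) (f : X -> set_type A) :
  continuous f <-> forall s, continuous (fun x => (set_val (f x) : S -> T) s).
Proof.
split=> fc => [s x|x].
  have [H _] := @cvg_ptws_subtype S T A (f @ x) (f x) _.
  exact: (H (fc x) s).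
have [_ H] := @cvg_ptws_subtype S T A (f @ x) (f x) _.
by apply: H => s; exact: fc.
Qed.

Section CpTopology.
Context {R : realType} {X : topologicalType}.
Local Open Scope ring_scope.

Definition Cp_eval (g : set_type (Cp R X)) : X -> R := set_val g.

Lemma Cp_eval_continuous g : continuous (Cp_eval g).
Proof. exact: (set_valP g). Qed.

Lemma Cp_eval_surj (f : X -> R) : continuous f -> exists g, Cp_eval g = f.
Proof.
move=> fC; have /mem_set fC' : Cp R X f by [].
by exists (exist _ (f : {ptws X -> R}) fC').
Qed.

Lemma Cp_eval_inj : injective Cp_eval.
Proof. by move=> f g; exact: val_inj. Qed.

Lemma nbhs_CpP (y : set_type (Cp R X)) (U : set (set_type (Cp R X))) :
  nbhs y U <-> exists F e, [/\ finite_set F, 0 < e &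
    forall g, (forall x, F x -> `|Cp_eval g x - Cp_eval y x| < e) -> U g].
Proof.
split=> [|[F [e [/finite_fsetP[D FD] e0]]]].
  (* The boxes generate a filter that converges to [y] at each point, hence converges to [y]; so
     each neighborhood of [y] contains a box. *)
  pose box (p : set X * R) : set (set_type (Cp R X)) :=
    [set g | forall x, p.1 x -> `|Cp_eval g x - Cp_eval y x| < p.2].
  pose B := filter_from [set p : set X * R | finite_set p.1 /\ 0 < p.2] box.
  have FB : Filter B.
    apply: filter_from_filter => [|p q [fp p0] [fq q0]].
      by exists (set0, 1); split=> /=.
    exists (p.1 `|` q.1, Num.min p.2 q.2).
      by split; rewrite /= ?finite_setU ?lt_min ?p0 ?q0.
    by move=> g gp; split=> x Fx; have := gp x; rewrite lt_min => /(_ _)/andP[];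
      rewrite //=; [left|right].
  have By : B --> y.
    apply/(@cvg_ptws_subtype _ _ _ B) => x.
    apply/cvgrPdist_lt => e e0; exists ([set x], e) => //= g /(_ x erefl).
    by rewrite distrC.
  by move=> /By[[F e] [/= finF e0] FU]; exists F, e.
move=> gU.
suff : nbhs y
    (\bigcap_(x in F) [set g | `|Cp_eval g x - Cp_eval y x| < e]).
  exact: filterS.
rewrite FD; apply: filter_bigI => x _.
have [/(_ cvg_id x)/cvgrPdist_lt/(_ e e0) + _] :=
  @cvg_ptws_subtype X R (Cp R X) (nbhs y) y _.
by apply: filterS => g; rewrite distrC.
Qed.

End CpTopology.

Lemma continuous_if_clopen (X T : topologicalType) (a b : T) (V : set X) :
  clopen V -> continuous (fun x => if x \in V then a else b).
Proof.
move=> [oV cV] x; apply: cvg_near_cst.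
have [Vx|Vx] := pselect (V x).
  have := open_nbhs_nbhs (conj oV Vx); apply: filterS => z Vz.
  by rewrite !mem_set.
have := open_nbhs_nbhs (conj (closed_openC cV) Vx); apply: filterS => z Vz.
by rewrite !memNset.
Qed.

(** * Equivalence of conditions (2) and (3) *)

(** This predicate and the next are the two halves of (2); the third one is (3). *)
Definition countable_omega_subcovers (X : topologicalType) : Prop :=
  forall U : set (set X), clopen_omega_cover U ->
    exists V : set (set X), [/\ V `<=` U, countable V & omega_cover V].

Definition sigma_pseudo_intersections (X : topologicalType) : Prop :=
  forall F : set (set nat),
    continuous_image X F -> free_family F -> centered F ->
    exists F_ : nat -> set (set nat),
      [/\ fin_meets F = \bigcup_n F_ n, trivIset setT F_ &
          forall n, exists A : set nat, pseudo_intersection (F_ n) A].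

Definition infinite_meet_covers (X : topologicalType) : Prop :=
  forall U : set (set X), clopen_omega_cover U ->
    exists U_ : nat -> set (set X),
      (forall n, U_ n `<=` U /\ infinite_set (U_ n)) /\
      omega_cover (range (fun n => \bigcap_(V in U_ n) V)).

(** One member chosen from each [U_ n] suffices, since it contains the intersection of [U_ n]. *)
Lemma infinite_meet_covers_countable (X : topologicalType) :
  infinite_meet_covers X -> countable_omega_subcovers X.
Proof.
move=> XC U Ucov; have [[UT _] _] := Ucov.
have [U_ [UP [_ Ucap]]] := XC U Ucov.
have /choice[v vP] n : exists V, U_ n V by exact/infinite_setN0/(UP n).2.
exists (range v); split; first by move=> _ [n _ <-]; exact/(UP n).1.
  exact: card_le_trans (card_image_le _ _) _.
split=> [[n _ vT]|F /Ucap[_ [n _ <-] FU]].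
  by apply: UT; rewrite -vT; exact/(UP n).1.
by exists (v n); [exists n | apply: subset_trans FU _; exact: bigcap_inf].
Qed.

Lemma fin_meets_range (X : Type) (h : X -> set nat) (B : set nat) :
  fin_meets (range h) B <->
  exists F : set X, [/\ finite_set F, F !=set0 & B = \bigcap_(x in F) h x].
Proof.
split=> [[G [finG [A GA] Gh ->]]|[F [finF [x Fx] ->]]].
  have [F finF GF] := finite_sub_range finG Gh.
  exists F; split=> //; last by rewrite GF bigcap_image.
  by move: GA; rewrite GF => -[x Fx _]; exists x.
exists (h @` F); split; first exact: finite_image.
- by exists (h x), x.
- by move=> _ [z _ <-]; exists z.
- by rewrite bigcap_image.
Qed.

Lemma nat_partition (T : Type) (A : set T) (P : nat -> set T) :
  (forall x, A x -> exists n, P n x) ->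
  exists A_ : nat -> set T,
    [/\ A = \bigcup_n A_ n, trivIset setT A_ & forall n, A_ n `<=` P n].
Proof.
move=> AP; exists (seqDU (fun n => A `&` P n)); split.
- rewrite -seqDU_bigcup_eq -setI_bigcupr; apply/esym/setIidl => x /AP[n Pnx].
  by exists n.
- exact: trivIset_seqDU.
- by move=> n; apply: subset_trans (@subset_seqDU _ _ n) _; exact: subIsetr.
Qed.

Lemma infinite_meet_covers_pseudo (X : topologicalType) :
  infinite_meet_covers X -> sigma_pseudo_intersections X.
Proof.
move=> XC F [Psi [PsiC ->]] Ffree Fcent.
pose h x := nat_subset (set_val (Psi x)).
pose U n := [set x | h x n].
(* Freeness excludes an empty [X], as the empty family has intersection [setT]. The point [x0] is
   then added to [D] to make the subfamily nonempty. *)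
have [x0 _] : exists x0 : X, True.
  apply: contrapT => X0; have : set0 0%N; last by [].
  by rewrite -Ffree => A [x _ _]; case: X0; exists x.
have hcap D : finite_set D -> exists n, forall x, D x -> h x n.
  move=> finD; have [|n hn] := @infinite_setN0 _ (\bigcap_(x in x0 |` D) h x).
    apply: Fcent; apply/fin_meets_range; exists (x0 |` D); split=> //.
      by rewrite finite_setU.
    by exists x0; left.
  by exists n => x Dx; apply: hn; right.
(* The sets [U n] form a clopen omega-cover: freeness keeps [setT] out, centeredness covers the
   finite sets, and continuity of [Psi] makes them clopen. *)
have [|U_ [UP [_ Ucap]]] := XC (range U).
  split; [split|].
  - move=> [n _ UT]; have : set0 n; last by [].
    rewrite -Ffree => _ [x _ <-].
    by have : [set: X] x by []; rewrite -UT.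
  - by move=> D /hcap[n hn]; exists (U n) => //; exists n.
  - move=> _ [n _ <-].
    apply: (@preimage_clopen _ _ (fun x => (set_val (Psi x) : nat -> bool) n)
      [set true]).
      by split; [exact: discrete_open | exact: discrete_closed].
    have [H _] := @continuous_ptws_subtype X nat bool inf_subsets Psi.
    exact: H PsiC n.
(* [U] maps [A k] onto [U_ k], so [A k] is infinite even if [U] repeats values. *)
pose A k := [set n | U_ k (U n)].
have infA k : infinite_set (A k).
  have [UkU infUk] := UP k.
  by have := infinite_preimage_image infUk UkU; rewrite setTI.
have [|F_ [F_cup F_triv F_A]] :=
    @nat_partition _ (fin_meets (range h)) (fun k => [set B | A k `<=` B]).
  move=> B /fin_meets_range[D [finD _ ->]].
  have [_ [k _ <-] DU] := Ucap D finD.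
  by exists k => n An x Dx; exact: (DU x Dx (U n) An).
exists F_; split=> // k; exists (A k); split=> // B /F_A AB.
by rewrite (_ : A k `\` B = set0)// setD_eq0.
Qed.

Lemma pseudo_infinite_meet_covers (X : topologicalType) :
  countable_omega_subcovers X -> sigma_pseudo_intersections X ->
  infinite_meet_covers X.
Proof.
move=> Xcount Xpseudo U0 [U0cov U0cl].
have [V [VU0 Vcount Vcov]] := Xcount U0 (conj U0cov U0cl).
have infV : infinite_set V.
  have := omega_cover_infinite_above Vcov (@finite_set0 X).
  by apply: sub_infinite_set => W [].
(* The enumeration is injective so that infinite sets of indices yield infinite subfamilies. *)
have [U [UV Uinj Usurj]] : exists U : nat -> set X, set_bij setT V U.
  exact/card_set_bijP/card_esym/eq_card_nat.
pose h x := [set n | U n x].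
have hcap D : finite_set D -> infinite_set (\bigcap_(x in D) h x).
  move=> finD; have VD := omega_cover_infinite_above Vcov finD.
  have := @infinite_preimage_image _ _ U setT _ VD; rewrite setTI => infUD.
  by apply: sub_infinite_set (infUD _) => [n [_ DU] x /DU //|W [/Usurj //]].
have hinf x : inf_subsets (fun n => x \in U n).
  have := hcap [set x] (finite_set1 x).
  apply: sub_infinite_set => n hn; exact/mem_set/hn.
pose Psi x : set_type inf_subsets := SigSub (mem_set (hinf x)).
have hE : h = (fun x => nat_subset (set_val (Psi x))).
  apply/funext => x; apply/funext => n; apply/propext.
  by split=> [/mem_set|/set_mem].
have [|||F_ [FE _ F_pi]] := Xpseudo (range h).
- exists Psi; split; last by rewrite hE.
  have [_] := @continuous_ptws_subtype X nat bool inf_subsets Psi; apply => n.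
  suff -> : (fun x => (set_val (Psi x) : nat -> bool) n) =
      (fun x => if x \in U n then true else false).
    exact/continuous_if_clopen/U0cl/VU0/UV.
  by apply/funext => x; case: ifP.
- rewrite /free_family bigcap_image -subset0 => n hn.
  have [+ _] := Vcov; apply; rewrite -(_ : U n = setT); first exact: UV.
  by rewrite -subTset => x _; exact: hn.
- by move=> B /fin_meets_range[D [finD _ ->]]; exact: hcap.
have /choice[A AP] := F_pi.
(* A pseudo-intersection lies in a given meet only up to a finite set, so all its tails are used,
   with the pairs (piece, starting point) listed in one sequence. *)
have [p pP] := nat_enum_countType (0%N, 0%N).
pose tail q := U @` [set k | A q.1 k /\ (q.2 <= k)%N].
exists (tail \o p).
have tailP k : (tail \o p) k `<=` U0 /\ infinite_set ((tail \o p) k).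
  split; first by move=> _ [n _ <-]; exact/VU0/UV.
  apply: infinite_image; last exact/infinite_nat_tail/(AP _).1.
  by move=> i j; apply: Uinj; rewrite inE.
split=> //; apply: omega_cover_bigcap => //; first exact: U0cov.1.
move=> D finD.
have [->|/set0P D0] := eqVneq D set0; first by exists 0%N => V0 _ x.
have : (\bigcup_n F_ n) (\bigcap_(x in D) h x).
  by rewrite -FE; apply/fin_meets_range; exists D.
move=> [n _ FnD]; have [_ /(_ _ FnD)/finite_set_nat_bounded[m mP]] := AP n.
(* The exceptional indices are at most [m], so the tail starting at [m.+1] avoids them all. *)
have [k pk] := pP (n, m.+1).
exists k => _ [i + <-] x Dx; rewrite pk => -[/= Ani mi].
apply: contrapT => Uix.
have : (i <= m)%N by apply: mP; split=> // /(_ x Dx).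
by rewrite leqNgt mi.
Qed.

(** * From the Pytkeev property to condition (3) *)

Section PytkeevMeetCovers.
Context {R : realType} {X : topologicalType}.
Local Open Scope ring_scope.

Lemma Cp_clopen_indic (V : set X) : clopen V ->
  exists g : set_type (Cp R X), forall x, Cp_eval g x = \1_(~` V) x.
Proof.
move=> clV.
have [g gE] := Cp_eval_surj (continuous_if_clopen (a := 0 : R) (b := 1) clV).
by exists g => x; rewrite gE indicE in_setC; case: (x \in V).
Qed.

Lemma pytkeev_infinite_meet_covers :
  pytkeev (set_type (Cp R X)) -> infinite_meet_covers X.
Proof.
move=> pyt U [Ucov Ucl].
have [y yE] := Cp_eval_surj (@cst_continuous X R 0).
(* The value [y] for a non-clopen [V] is a mere default; all members of [U] are clopen. *)
have /choice[f fE] : forall V, exists g : set_type (Cp R X),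
    clopen V -> forall x, Cp_eval g x = \1_(~` V) x.
  move=> V; have [/Cp_clopen_indic[g gE]|nV] := pselect (clopen V).
    by exists g.
  by exists y.
have [|A_ [A_P yA_]] := pyt (f @` U) y.
  split=> [B /nbhs_CpP[F [e [finF e0 FB]]]|[V UV fV]].
    have [V UV FV] := Ucov.2 F finF.
    exists (f V); split; first by exists V.
    apply: FB => x /FV Vx; rewrite yE (fE _ (Ucl _ UV)) indicE memNset.
      by rewrite subrr normr0.
    exact.
  apply: Ucov.1; rewrite -(_ : V = setT)// -subTset => x _.
  apply: contrapT => Vx; have := fE _ (Ucl _ UV) x.
  rewrite fV yE indicE mem_set//= => /esym/eqP.
  by rewrite oner_eq0.
pose W n := U `&` f @^-1` A_ n.
have WP n : W n `<=` U /\ infinite_set (W n).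
  split; first exact: subIsetl.
  exact: infinite_preimage_image (A_P n).2 (A_P n).1.
exists W; split=> //; apply: omega_cover_bigcap => //; first exact: Ucov.1.
move=> F finF.
(* Radius 1 suffices: an indicator value less than 1 is 0, so a function in this neighborhood comes
   from a [V] containing [F]. *)
have [|n An] := yA_ [set g | forall x, F x -> `|Cp_eval g x - Cp_eval y x| < 1].
  by apply/nbhs_CpP; exists F, 1; split.
exists n => V [UV AnV] x Fx; apply: contrapT => Vx.
have := An _ AnV x Fx; rewrite yE (fE _ (Ucl _ UV)) indicE mem_set// subr0.
by rewrite normr1 ltxx.
Qed.

End PytkeevMeetCovers.

(** * Countable clopen covers and clopen separation *)

(** The assumption [O set0] supplies a constant sequence when the countable subcover is empty. *)
Lemma clopen_lindelof (X : topologicalType) (O : set (set X)) :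
  countable_omega_subcovers X -> O `<=` clopen -> O set0 ->
  (forall x, exists2 V, O V & V x) ->
  exists V : nat -> set X, (forall k, O (V k)) /\ \bigcup_k V k = setT.
Proof.
move=> Xcount Ocl O0 Ocov.
suff [G [Gcount GO GT]] : exists G : set (set X),
    [/\ countable G, G `<=` O & forall x, exists2 V, G V & V x].
  have [G0|[V]] := pfcard_geP Gcount.
    exists (fun=> set0); split=> //; rewrite -subTset => x _.
    by have [V] := GT x; rewrite G0.
  exists V; split=> [k|]; first exact/GO/funS.
  rewrite -subTset => x _; have [W GW Wx] := GT x.
  have [k _ kW] := @surj _ _ _ _ V _ GW.
  by exists k; rewrite ?kW.
(* Finite unions turn a cover of points into an omega-cover. *)
pose union (G : set (set X)) := \bigcup_(V in G) V.
pose W := union @` [set G | finite_set G /\ G `<=` O].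
(* Either finitely many members of [O] already cover [X], or [W] omits [setT] and is a clopen
   omega-cover; a countable omega-subcover then splits back into countably many members of [O]. *)
have [[G [finG GO] GT]|WT] := pselect (W setT).
  exists G; split=> // [|x]; first exact: finite_set_countable.
  have : [set: X] x by [].
  by rewrite -GT => -[V GV Vx]; exists V.
have [|V [VW Vcount Vcov]] := Xcount W.
  split; first split=> // F finF.
    have /choice[v vP] x : exists V, O V /\ V x.
      by have [V OV Vx] := Ocov x; exists V.
    exists (union (v @` F)).
      exists (v @` F) => //; split; first exact: finite_image.
      by move=> _ [x _ <-]; exact: (vP x).1.
    by move=> x Fx; exists (v x); [exists x | exact: (vP x).2].
  move=> _ [G [finG GO] <-]; split.
    by apply: bigcup_open => V /GO/Ocl[].
  by apply: closed_bigcup => // V /GO/Ocl[].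
have /choice[g gP] : forall A, exists G, W A ->
    [/\ finite_set G, G `<=` O & union G = A].
  move=> A; have [[G [finG GO] GA]|] := pselect (W A).
    by exists G.
  by exists set0.
exists (\bigcup_(A in V) g A); split.
- apply: bigcup_countable => // A VA; apply: finite_set_countable.
  by have [] := gP _ (VW _ VA).
- by move=> B [A VA]; have [_ + _] := gP _ (VW _ VA); apply.
- move=> x; have [A VA /(_ x erefl)] := Vcov.2 [set x] (finite_set1 x).
  have [_ _ <-] := gP _ (VW _ VA) => -[B gB Bx].
  by exists B => //; exists A.
Qed.

(** A countable clopen cover by sets inside [P] or inside [Q] is made disjoint, with clopen pieces.
    The pieces coming from sets inside [P] form [C]; the others form its complement, so both unions
    are open. *)
Lemma clopen_separation (X : topologicalType) (P Q : set X) :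
  has_clopen_base X -> countable_omega_subcovers X ->
  open P -> open Q -> P `|` Q = setT ->
  exists C : set X, [/\ clopen C, C `<=` P & ~` C `<=` Q].
Proof.
move=> [B [[_ Bbase] Bcl]] Xcount oP oQ PQ.
have [||x|V [VO VT]] := @clopen_lindelof X
    [set V | clopen V /\ (V `<=` P \/ V `<=` Q)] Xcount.
- by move=> V [].
- by split; [exact: clopen0 | left].
- have [Px|Qx] : (P `|` Q) x by rewrite PQ.
    have [V [BV Vx] VP] := Bbase x P (open_nbhs_nbhs (conj oP Px)).
    by exists V => //; split; [exact: Bcl | left].
  have [V [BV Vx] VQ] := Bbase x Q (open_nbhs_nbhs (conj oQ Qx)).
  by exists V => //; split; [exact: Bcl | right].
have oV k : open (seqDU V k).
  rewrite /seqDU -bigcup_mkord setDE; apply: openI; first exact: (VO k).1.1.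
  by apply/closed_openC/closed_bigcup => // i _; exact: (VO i).1.2.
pose I := [set k | V k `<=` P].
have CE : ~` (\bigcup_(k in I) seqDU V k) = \bigcup_(k in ~` I) seqDU V k.
  apply/seteqP; split=> [x Ix|x [k nIk kx] [j Ij jx]].
    have [k _ kx] : (\bigcup_k seqDU V k) x by rewrite -seqDU_bigcup_eq VT.
    by exists k => // Ik; apply: Ix; exists k.
  apply: nIk; rewrite (trivIset_seqDU V k j) //; by exists x.
exists (\bigcup_(k in I) seqDU V k); split.
- split; first by apply: bigcup_open => k _; exact: oV.
  by rewrite -openC CE; apply: bigcup_open => k _; exact: oV.
- by apply: bigcup_sub => k; exact: subset_trans (@subset_seqDU _ V k).
- rewrite CE; apply: bigcup_sub => k Ik.
  apply: subset_trans (@subset_seqDU _ V k) _.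
  by have [_ [VP|]] := VO k; [case: (Ik VP) | exact].
Qed.

(** * From condition (3) to the Pytkeev property *)

Section MeetCoversPytkeev.
Context {R : realType} {X : topologicalType}.
Local Open Scope ring_scope.

Lemma infinite_meet_covers_pytkeev :
  has_clopen_base X -> infinite_meet_covers X -> pytkeev (set_type (Cp R X)).
Proof.
move=> Xbase XC A y [Ay nAy].
pose dist g x := `|Cp_eval g x - Cp_eval y x|.
have distC g : continuous (dist g).
  move=> x; apply: cvg_norm; apply: cvgB; exact: Cp_eval_continuous.
(* With e = 1/(n+1), the clopen set lies between {dist <= e/2} and {dist < e}: the inner bound will
   give covers, the outer one estimates. *)
have /choice[c cP] (ng : nat * set_type (Cp R X)) :
    exists C : set X, [/\ clopen C,
      C `<=` [set x | dist ng.2 x < ng.1.+1%:R^-1] &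
      ~` C `<=` [set x | ng.1.+1%:R^-1 / 2 < dist ng.2 x]].
  apply: clopen_separation => //.
  - exact: infinite_meet_covers_countable.
  - have /continuousP := distC ng.2; move=> distP.
    exact: (distP _ (@open_lt _ (ng.1.+1%:R^-1 : R))).
  - have /continuousP := distC ng.2; move=> distP.
    exact: (distP _ (@open_gt _ (ng.1.+1%:R^-1 / 2 : R))).
  - rewrite -subTset => x _ /=.
    have : 0 < ng.1.+1%:R^-1 :> R by rewrite invr_gt0.
    set e := ng.1.+1%:R^-1 => e0.
    case: (ltP (dist ng.2 x) e) => [|de]; [by left|right].
    lra.
have [cofT|/existsNP[N NT]] := pselect (forall N, exists n g,
    [/\ (N <= n)%N, A g & c (n, g) = setT]).
  pose A_ k := [set g | A g /\ forall x, dist g x < k.+1%:R^-1].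
  have A_dec m n : (m <= n)%N -> A_ n `<=` A_ m.
    move=> mn g [Ag gn]; split=> // x; apply: lt_le_trans (gn x) _.
    by rewrite lef_pV2 ?posrE// ler_nat.
  exists A_; split=> [k|U /nbhs_CpP[F [e [_ e0 FU]]]].
    split; first by move=> g [].
    apply: infinite_decreasing_sets => // [n|].
      have [m [g [nm Ag gT]]] := cofT n.
      exists g; apply: (A_dec _ m) => //; split=> // x.
      have [_ + _] := cP (m, g); apply.
      by rewrite gT.
    (* A function in every [A_ k] equals [y], which is not in [A]. *)
    rewrite -subset0 => g gA; apply: nAy.
    have -> : y = g; last by have [] := gA 0%N I.
    apply: Cp_eval_inj; apply/funext => x.
    apply/eqP; rewrite eq_sym -subr_eq0 -normr_le0 leNgt.
    apply/negP => d0.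
    have [n _ nP] := near_infty_natSinv_lt (PosNum d0).
    have := nP n (leqnn n); rewrite /= ltNge => /negP; apply.
    by apply: ltW; have [_] := gA n I; apply.
  have [n _ nP] := near_infty_natSinv_lt (PosNum e0).
  exists n => g [_ gn]; apply: FU => x _.
  exact: lt_trans (gn x) (nP n (leqnn n)).
(* The shift by [N] keeps [setT] out of the cover. For finite [F], the closure hypothesis gives a
   function of [A] within half the radius on [F], whose clopen set contains [F]. *)
have Ncov n : clopen_omega_cover ((fun g => c ((N + n)%N, g)) @` A).
  split; first split.
  - move=> [g Ag gT]; apply: NT; exists (N + n)%N, g; split=> //.
    exact: leq_addr.
  - move=> F finF.
    have [|g [Ag gF]] := Ay [set g | forall x, F x ->
        dist g x < (N + n).+1%:R^-1 / 2].
      by apply/nbhs_CpP; exists F, ((N + n).+1%:R^-1 / 2); split.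
    exists (c ((N + n)%N, g)); first by exists g.
    move=> x Fx; apply: contrapT.
    have [_ _ /[apply]/=/lt_trans/(_ (gF x Fx))] := cP ((N + n)%N, g).
    by rewrite ltxx.
  - by move=> _ [g _ <-]; have [] := cP ((N + n)%N, g).
have /choice[U_ UP] n := XC _ (Ncov n).
have [p pP] := nat_enum_countType (0%N, 0%N).
(* The functions of [A] whose clopen set at level [N + q.1] belongs to the infinite family
   [U_ q.1 q.2]; as that family is their image, they are infinitely many. *)
pose A_ (q : nat * nat) := A `&` (fun g => c ((N + q.1)%N, g)) @^-1` U_ q.1 q.2.
exists (A_ \o p); split=> [k|U /nbhs_CpP[F [e [finF e0 FU]]]].
  split; first exact: subIsetl.
  have [/(_ (p k).2)[UA infU] _] := UP (p k).1.
  exact: infinite_preimage_image infU UA.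
have [n ne] : exists n, (N + n).+1%:R^-1 < e.
  have [n _ nP] := near_infty_natSinv_lt (PosNum e0).
  by exists n; apply: nP; exact: leq_addl.
have [_ [_ /(_ F finF)[_ [m _ <-] FV]]] := UP n.
have [k pk] := pP (n, m).
exists k => g; rewrite /= pk => -[Ag Ug]; apply: FU => x Fx.
apply: lt_trans ne.
have [_ + _] := cP ((N + n)%N, g); apply.
exact: (FV x Fx).
Qed.

End MeetCoversPytkeev.

Theorem corollary17 (R : realType) (X : topologicalType)
    (zdX : has_clopen_base X) :
  let C1 : Prop := pytkeev (set_type (Cp R X)) in
  let C2 : Prop :=
    (forall U : set (set X), clopen_omega_cover U ->
       exists V : set (set X), [/\ V `<=` U, countable V & omega_cover V]) /\
    (forall F : set (set nat),
       continuous_image X F -> free_family F -> centered F ->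
       exists F_ : nat -> set (set nat),
         [/\ fin_meets F = \bigcup_n F_ n,
             trivIset setT F_ &
             forall n, exists A : set nat, pseudo_intersection (F_ n) A]) in
  let C3 : Prop :=
    forall U : set (set X), clopen_omega_cover U ->
      exists U_ : nat -> set (set X),
        (forall n, U_ n `<=` U /\ infinite_set (U_ n)) /\
        omega_cover (range (fun n => \bigcap_(V in U_ n) V)) in
  (C1 <-> C2) /\ (C2 <-> C3).
Proof.
have C23 : countable_omega_subcovers X /\ sigma_pseudo_intersections X <->
    infinite_meet_covers X.
  split=> [[]|XC]; first exact: pseudo_infinite_meet_covers.
  split; first exact: infinite_meet_covers_countable.
  exact: infinite_meet_covers_pseudo.
split; last exact: C23.
split=> [/pytkeev_infinite_meet_covers/C23 //|/C23].
exact: infinite_meet_covers_pytkeev.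
Qed.
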